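(* Let $n\ge 3$ and let $\mathbf{w_0}=(s_1 s_2\cdots s_{n-1})(s_1 s_2\cdots s_{n-2})\cdots(s_1 s_2)(s_1)$, a reduced word for the longest element of $\mathfrak{S}_n$. Let $C$ be the commutation class of $\mathbf{w_0}$. Then the average, over all words $\mathbf{w}\in C$, of the number of braid moves in $\mathbf{w}$ equals $1$; equivalently, $\sum_{\mathbf{w}\in C}\mathrm{br}(\mathbf{w})=|C|$.
   Context: $\mathfrak{S}_n$ is generated by the simple transpositions $s_i=(i,i+1)$, $1\le i<n$. A word is a sequence $s_{i_1}s_{i_2}\cdots s_{i_m}$ of simple transpositions. The commutation class of a reduced word $\mathbf{w}$ is the set of all words obtainable from $\mathbf{w}$ by repeatedly replacing an adjacent factor $s_is_j$ with $|i-j|>1$ by $s_js_i$. For a word $s_{i_1}\cdots s_{i_m}$, a braid move is a position $1\le j\le m-2$ such that $(i_j,i_{j+1},i_{j+2})$ equals $(a,a+1,a)$ or $(a+1,a,a+1)$ for some $a$ (so the factor $s_as_{a+1}s_a$ or $s_{a+1}s_as_{a+1}$ can be replaced by the other); $\mathrm{br}(\mathbf{w})$ denotes the number of braid moves of $\mathbf{w}$. *)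

(* Defs.v *)
From mathcomp Require Import all_boot all_order all_fingroup all_algebra.
Set Implicit Arguments.
Unset Strict Implicit.
Unset Printing Implicit Defensive.

(** Words in the simple transpositions s_1, ..., s_r of S_(r+1) are encoded by
    their indices, shifted by one: the letter [i : 'I_r] stands for s_(i+1).
    The conditions |i - j| > 1 and j = i +- 1 below are shift-invariant.
    Words of length [m] are tuples, so that they form a finite type; positions
    are elements of ['I_m], numbered from 0. *)
Definition word (r m : nat) := m.-tuple 'I_r.

(** [v] is [u] with the commuting letters at positions [p], [p + 1] exchanged. *)
Definition comm_step (r m : nat) : rel (word r m) := fun u v =>
  [exists p : 'I_m, exists q : 'I_m,
    [&& q == p.+1 :> nat,
        1 < `|tnth u p - tnth u q|
      & v == [tuple tnth u (tperm p q k) | k < m]]].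

Definition comm_class (r m : nat) (w : word r m) : {set word r m} :=
  [set v | connect (@comm_step r m) w v].

(** (i, j, k) is (a, a+1, a) or (a+1, a, a+1). *)
Definition braid_pattern (i j k : nat) : bool :=
  (k == i) && ((j == i.+1) || (i == j.+1)).

Definition br (r m : nat) (w : word r m) : nat :=
  #|[set p : 'I_m | [exists q : 'I_m, exists t : 'I_m,
       [&& q == p.+1 :> nat, t == p.+2 :> nat
         & braid_pattern (tnth w p) (tnth w q) (tnth w t)]]]|.

(** (s_1 ... s_(n-1)) (s_1 ... s_(n-2)) ... (s_1 s_2) (s_1); the block of
    length [k] consists of the first [k] letters. *)
Definition w0_seq (n : nat) : seq 'I_n.-1 :=
  flatten [seq take k (enum 'I_n.-1) | k <- rev (iota 1 n.-1)].

Definition w0 (n : nat) : word n.-1 (size (w0_seq n)) := in_tuple (w0_seq n).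

(* Main.v *)
(** Write the words with letters 1, ..., r, padded by a 0 at both ends, and let
    occ C x y z be the number of occurrences of the factor x y z in all words
    of C.  Exchanging commuting letters x, y gives occ C x y z = occ C y x z and
    occ C z x y = occ C z y x.  Every occurrence of a factor x y has exactly one
    predecessor and one successor, so the sum over z of occ C z x y equals that
    of occ C x y z; when {x, y} = {k, k+1}, a letter z commuting with both
    contributes equally to the two sides, and only z = k-1, ..., k+2 remain.

    Commutations preserve the subword on the letters k, k+1, which is
    k, k+1, k, ..., k+1, k for w0.  Hence no word of C has a factor j j, the only
    braids are 1 2 1, and each word begins with 1 2 and ends with 2 1.  Let
      K(k) = occ(k-1,k,k+1) + occ(k+1,k,k-1) - occ(k-1,k+1,k) - occ(k,k-1,k+1).
    The flow identities for the factors k k+1 and k+1 k add up to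
    K(k) = K(k+1) for k > 1 and to 2 |C| = K(2) + 2 occ(1,2,1) for k = 1.
    As r+1 is not a letter, K(r) = 0, whence occ(1,2,1) = |C|. *)
Require Import Defs.
From mathcomp Require Import all_boot all_order all_fingroup all_algebra.
From mathcomp Require Import zify.
Set Implicit Arguments.
Unset Strict Implicit.
Unset Printing Implicit Defensive.
Local Open Scope nat_scope.

(** * Commuting letters and alternating sequences *)

Definition far (a b : nat) : bool := (a.+1 < b) || (b.+1 < a).

Lemma far_sym a b : far a b = far b a.
Proof. by rewrite /far orbC. Qed.

Lemma distn_gt1 (a b : nat) :
  (1 < ssrint.absz (ssrint.Posz a - ssrint.Posz b)%R) = far a b.
Proof. rewrite /far; lia. Qed.

Definition subword (k : nat) (s : seq nat) : seq nat :=
  [seq x <- s | (x == k) || (x == k.+1)].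

(** For [0 < k] the default 0 rules out the empty sequence. *)
Definition alternating (k : nat) (s : seq nat) : bool :=
  [&& head 0 s == k, last 0 s == k & sorted (fun x y => x != y) s].

(** A first letter [x > 1] would start the subword on [x.-1], [x] with the wrong letter. The second
    letter is not 1 by alternation for [k = 1], and a second letter [y > 2] fails like [x], since 1
    is filtered out. *)
Lemma alternating_start r (s : seq nat) : 1 < r ->
  all (fun x => 0 < x <= r) s ->
  (forall k, 0 < k <= r -> alternating k (subword k s)) ->
  exists t, s = [:: 1, 2 & t].
Proof.
move=> hr; case: s => [_ /(_ 1)|x s /= /andP [hx hs] hk].
  by rewrite (ltnW hr) => /(_ isT).
have ex : x = 1.
  have := hk x.-1; rewrite /alternating /subword /=.
  have -> : (x == x.-1.+1) = true by lia.
  rewrite orbT /=; lia.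
subst x; case: s hs hk => [_ /(_ 2)|y s /= /andP [hy _] hk].
  by rewrite hr => /(_ isT).
exists s; do 2 congr (_ :: _).
have y1 : y <> 1.
  by move=> e; have := hk 1 hx; rewrite e /alternating /subword /= andbF.
have := hk y.-1; rewrite /alternating /subword /=.
have -> : (y == y.-1.+1) = true by lia.
rewrite orbT; case: ifP => /=; lia.
Qed.

Lemma alternating_rev k s :
  alternating k (subword k (rev s)) = alternating k (subword k s).
Proof.
rewrite /alternating /subword filter_rev rev_sorted andbCA.
set t := filter _ _.
have -> : head 0 (rev t) = last 0 t.
  by case/lastP: t => // t x; rewrite rev_rcons last_rcons.
have -> : last 0 (rev t) = head 0 t.
  by case: t => //= x t; rewrite rev_cons last_rcons.
congr [&& _, _ & _].
by apply: eq_sorted => x y; rewrite eq_sym.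
Qed.

(** * Padded words and commutation steps *)

Section Words.

Variables r m : nat.
Implicit Types (w u v : word r m) (x y z k p : nat).

(* The zeros at both ends behave like a letter s_0: words beginning or ending
   with a given factor are counted by occurrences of a longer factor. *)
Definition padded w : seq nat := 0 :: rcons [seq (val i).+1 | i <- w] 0.

Definition letter w p : nat := nth 0 (padded w) p.

Lemma size_padded w : size (padded w) = m.+2.
Proof. by rewrite /= size_rcons size_map size_tuple. Qed.

Lemma letter0 w : letter w 0 = 0.
Proof. by []. Qed.

Lemma letterS w (i : 'I_m) : letter w i.+1 = (tnth w i).+1.
Proof.
rewrite /letter /= nth_rcons size_map size_tuple ltn_ord.
have x0 := tnth w i.
by rewrite (nth_map x0) ?size_tuple // (tnth_nth x0).
Qed.

Lemma letter_out w p : m < p -> letter w p = 0.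
Proof.
case: p => // p; rewrite ltnS => h.
rewrite /letter /= nth_rcons size_map size_tuple ltnNge h /=.
by case: eqP.
Qed.

Lemma letter_gt0 w p : (0 < letter w p) = (0 < p <= m).
Proof.
case: p => [|p]; first by rewrite letter0.
case: (ltnP p m) => h; last by rewrite letter_out.
by rewrite (letterS w (Ordinal h)).
Qed.

Lemma letter_le w p : letter w p <= r.
Proof.
case: p => // p; case: (ltnP p m) => h; last by rewrite letter_out.
by rewrite (letterS w (Ordinal h)).
Qed.

Lemma letter_inj u v : letter u =1 letter v -> u = v.
Proof.
move=> h; apply: eq_from_tnth => i; apply: val_inj.
by have := h i.+1; rewrite !letterS => -[].
Qed.

(* Positions refer to the padded word: [swap p] exchanges the letters at the
   positions [p] and [p.+1] if both carry letters of [w]. *)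
Definition swap p w : word r m :=
  (* This test excludes [p = 0], the left padding; [insub] fails past the right end. In both cases
     [swap p] is the identity, hence a total involution. *)
  if p.-1.+1 == p then
    if insub p.-1 is Some i then
      if insub p is Some j then [tuple tnth w (tperm i j l) | l < m] else w
    else w
  else w.

Lemma letter_swap p w i : 0 < p < m ->
  letter (swap p w) i =
    letter w (if i == p then p.+1 else if i == p.+1 then p else i).
Proof.
case: p => // p /= h; rewrite /swap /= eqxx.
have h' : p < m by apply: ltnW.
rewrite !insubT /=.
case: i => [|i]; first by rewrite !letter0.
rewrite !eqSS.
case: (ltnP i m) => hi; last first.
  rewrite letter_out //; case: eqP => [e|_]; first by lia.
  by case: eqP => [e|_]; [lia | rewrite letter_out].
rewrite (letterS _ (Ordinal hi)) tnth_mktuple.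
case: tpermP => [/(congr1 val) /= ->|/(congr1 val) /= ->|].
- by rewrite eqxx -letterS.
- by rewrite eqxx (gtn_eqF (ltnSn p)) -letterS.
move=> n1 n2; case: eqP => [e|_]; first by case: n1; apply: val_inj.
case: eqP => [e|_]; first by case: n2; apply: val_inj.
by rewrite -letterS.
Qed.

Lemma swapK p w : swap p (swap p w) = w.
Proof.
case: (boolP (0 < p < m)) => [h|h].
  apply: letter_inj => i; rewrite !letter_swap //.
  by congr (letter w _); repeat case: eqP => //; lia.
suff hs v : swap p v = v by rewrite !hs.
rewrite /swap; case: eqP => // e; case: insubP => // i hi _; case: insubP => // j hj _.
by move: h; lia.
Qed.

Lemma comm_step_swap p w : 0 < p < m -> far (letter w p) (letter w p.+1) ->
  comm_step w (swap p w).
Proof.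
case: p => // p /= h; have h' : p < m by apply: ltnW.
rewrite (letterS w (Ordinal h)) (letterS w (Ordinal h')) => hf.
apply/existsP; exists (Ordinal h'); apply/existsP; exists (Ordinal h).
rewrite /= eqxx /=; apply/andP; split.
  by rewrite distn_gt1 /far; move: hf; rewrite /far !ltnS.
by apply/eqP; rewrite /swap /= eqxx !insubT.
Qed.

Lemma comm_stepP u v : comm_step u v ->
  exists2 p, 0 < p < m & far (letter u p) (letter u p.+1) /\ v = swap p u.
Proof.
case/existsP => i /existsP [j /and3P [/eqP e hf /eqP ->]].
exists i.+1; first by rewrite /= -e ltn_ord.
split.
  by rewrite letterS -e letterS; move: hf; rewrite distn_gt1 /far !ltnS.
by rewrite /swap /= eqxx -e !valK.
Qed.

Lemma comm_step_sym u v : comm_step u v -> comm_step v u.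
Proof.
case/comm_stepP => p hp [hf ->]; rewrite -{2}(swapK p u).
by apply: comm_step_swap => //; rewrite !letter_swap // !eqxx (gtn_eqF (ltnSn p)) far_sym.
Qed.

Lemma padded_split w p : p < m ->
  padded w = take p (padded w)
    ++ [:: letter w p, letter w p.+1 & drop p.+2 (padded w)].
Proof.
move=> h; rewrite -{1}(cat_take_drop p (padded w)).
by rewrite (drop_nth 0) ?size_padded ?(drop_nth 0 (n := p.+1)) ?size_padded //; lia.
Qed.

(** Two far letters cannot both lie in [k], [k.+1], so the filter keeps at most one of them and does
    not see their exchange. *)
Lemma subword_step k u v : comm_step u v ->
  subword k (padded u) = subword k (padded v).
Proof.
case/comm_stepP => p hp [hf ->].
have hpm : p < m by case/andP: hp.
rewrite (padded_split u hpm) (padded_split (swap p u) hpm).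
rewrite !letter_swap // !eqxx (gtn_eqF (ltnSn p)).
have -> : take p (padded (swap p u)) = take p (padded u).
  apply: (@eq_from_nth _ 0) => [|i]; first by rewrite !size_take !size_padded.
  rewrite size_takel ?size_padded; last by lia.
  move=> hi; rewrite !nth_take // -!/(letter _ _) letter_swap //.
  by congr (letter u _); repeat case: eqP => //; lia.
have -> : drop p.+2 (padded (swap p u)) = drop p.+2 (padded u).
  apply: (@eq_from_nth _ 0) => [|i]; first by rewrite !size_drop !size_padded.
  rewrite !nth_drop -!/(letter _ _) letter_swap // => _.
  by congr (letter u _); repeat case: eqP => //; lia.
rewrite /subword !filter_cat /=; congr (_ ++ _).
move: hf; rewrite /far; by repeat case: eqP => //=; lia.
Qed.

(** * Factors excluded by alternation *)

Definition alternating_word w :=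
  forall k, 0 < k <= r -> alternating k (subword k [seq (val i).+1 | i <- w]).

Lemma subword_padded k w : 0 < k ->
  subword k (padded w) = subword k [seq (val i).+1 | i <- w].
Proof.
by case: k => // k _; rewrite /subword /padded /= filter_rcons.
Qed.

(** Filtering commutes with concatenation, so a factor of the word filters to a factor of its
    subword. *)
Lemma sorted_factor k w p : alternating_word w -> 0 < k <= r ->
  sorted (fun x y => x != y)
    (subword k [:: letter w p; letter w p.+1; letter w p.+2]).
Proof.
move=> hw hk; case: (ltnP p m) => hp; last first.
  have k0 : 0 < k by case/andP: hk.
  rewrite (@letter_out w p.+1) // (@letter_out w p.+2) ?ltnS ?leqW //.
  by case: k k0 {hk} => // k _; rewrite /subword /=; case: (_ || _).
case/and3P: (hw k hk) => _ _; rewrite -subword_padded; last by case/andP: hk.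
rewrite (padded_split w hp) (drop_nth 0) ?size_padded // -/(letter w p.+2).
rewrite /subword filter_cat => /cat_sorted2 [_].
by rewrite -[[:: _, _, _ & _]]/([:: _; _; _] ++ _) filter_cat => /cat_sorted2 [].
Qed.

Lemma letter_neq w p j :
  alternating_word w -> letter w p = j -> letter w p.+1 = j -> j = 0.
Proof.
move=> hw e1 e2; case: j e1 e2 => // j e1 e2.
have hj : 0 < j.+1 <= r by rewrite -e1 letter_le e1.
have := sorted_factor p hw hj; rewrite e1 e2 /subword /= eqxx /=.
by case: ifP => //= _; rewrite eqxx.
Qed.

(** Filtering out [b] leaves two adjacent letters [a]. *)
Lemma letter_braid w p a b k : alternating_word w -> 0 < k <= r ->
  (a == k) || (a == k.+1) -> ~~ ((b == k) || (b == k.+1)) ->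
  letter w p = a -> letter w p.+1 = b -> letter w p.+2 = a -> False.
Proof.
move=> hw hk ha hb e1 e2 e3; have := sorted_factor p hw hk.
by rewrite e1 e2 e3 /subword /= ha (negbTE hb) /= eqxx.
Qed.

(** Positions past the padding read the default 0; a factor with [0 < y] never reaches them. *)
Definition occ (C : {set word r m}) x y z : nat :=
  \sum_(w in C) \sum_(p < m.+2)
    [&& letter w p == x, letter w p.+1 == y & letter w p.+2 == z].

(** * Swap and flow identities for a set closed under commutations *)

Section Class.

Variable C : {set word r m}.
Hypothesis closedC : forall u v, comm_step u v -> (u \in C) = (v \in C).

Lemma sum_swap p a b (Q : pred (word r m)) :
  0 < a -> 0 < b -> far a b -> (forall w, 0 < p < m -> Q (swap p w) = Q w) ->
  \sum_(w in C) [&& letter w p == a, letter w p.+1 == b & Q w] =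
  \sum_(w in C) [&& letter w p == b, letter w p.+1 == a & Q w].
Proof.
move=> a0 b0 hab hQ; case: (boolP (0 < p < m)) => hp; last first.
  have e0 w c d : 0 < c -> 0 < d ->
      [&& letter w p == c, letter w p.+1 == d & Q w] = false.
    move=> c0 d0; apply/negP => /and3P [/eqP e1 /eqP e2 _].
    have := letter_gt0 w p; have := letter_gt0 w p.+1; rewrite e1 e2 c0 d0.
    by move: hp; lia.
  by rewrite !big1 // => w _; rewrite e0.
(* The sums are extended to all words because [swap p] need not preserve [C]; membership is compared
   only where the letters at [p], [p.+1] are [b], [a]. *)
rewrite (reindex_inj (can_inj (swapK p))) big_mkcond [RHS]big_mkcond /=.
apply: eq_bigr => w _; rewrite !letter_swap // !eqxx (gtn_eqF (ltnSn p)) hQ //.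
case: eqP => e1; case: eqP => e2; rewrite /= ?if_same //.
have hs : comm_step w (swap p w) by apply: comm_step_swap; rewrite // e1 e2 far_sym.
by rewrite -(closedC hs).
Qed.

Lemma occ_swapl a b z : 0 < a -> 0 < b -> far a b -> occ C a b z = occ C b a z.
Proof.
move=> a0 b0 hab; rewrite /occ exchange_big [RHS]exchange_big /=.
apply: eq_bigr => p _.
apply: (@sum_swap p a b (fun w => letter w p.+2 == z)) => // w hp.
by rewrite letter_swap //; congr (letter w _ == z); repeat case: eqP => //; lia.
Qed.

Lemma occ_swapr a b z : 0 < a -> 0 < b -> far a b -> occ C z a b = occ C z b a.
Proof.
move=> a0 b0 hab; rewrite /occ exchange_big [RHS]exchange_big /=.
apply: eq_bigr => p _; under eq_bigr do rewrite andbC -andbA.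
under [RHS]eq_bigr do rewrite andbC -andbA.
apply: (@sum_swap p.+1 a b (fun w => letter w p == z)) => // w hp.
by rewrite letter_swap //; congr (letter w _ == z); repeat case: eqP => //; lia.
Qed.

Lemma sum_letter w p n : r < n -> \sum_(z < n) (letter w p == z) = 1.
Proof.
move=> hn; have h : letter w p < n by apply: leq_ltn_trans hn; apply: letter_le.
rewrite (bigD1 (Ordinal h)) //= eqxx big1 ?addn0 // => z.
by rewrite -val_eqE /= eq_sym => /negbTE ->.
Qed.

(** Both sides count the occurrences of the factor [x y], each having exactly one neighbour on
    either side thanks to the padding. *)
Lemma occ_flow x y n : 0 < x -> 0 < y -> r < n ->
  \sum_(z < n) occ C z x y = \sum_(z < n) occ C x y z.
Proof.
move=> x0 y0 hn; rewrite /occ exchange_big [RHS]exchange_big /=.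
apply: eq_bigr => w _; rewrite exchange_big [RHS]exchange_big /=.
pose g p : nat := (letter w p == x) && (letter w p.+1 == y).
transitivity (\sum_(p < m.+2) g p.+1).
  apply: eq_bigr => p _; rewrite -[RHS]muln1 -(sum_letter w p hn) big_distrr /=.
  by apply: eq_bigr => z _; rewrite /g; do 3 case: (_ == _).
transitivity (\sum_(p < m.+2) g p); last first.
  apply: eq_bigr => p _; rewrite -[LHS]muln1 -(sum_letter w p.+2 hn) big_distrr /=.
  by apply: eq_bigr => z _; rewrite /g; do 3 case: (_ == _).
(* The two sums differ by an index shift; the boundary terms vanish since [x] is not a padding
   letter. *)
have g0 : g 0 = 0 by rewrite /g letter0; case: (x) x0.
have gm : g m.+2 = 0 by rewrite /g (@letter_out w m.+2) ?leqnSn //; case: (x) x0.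
by rewrite big_ord_recr /= gm addn0 [RHS]big_ord_recl /= g0.
Qed.

Hypothesis alternatingC : forall w, w \in C -> alternating_word w.

Lemma occ0 x y z :
  (forall w p, alternating_word w -> letter w p = x -> letter w p.+1 = y ->
     letter w p.+2 = z -> False) ->
  occ C x y z = 0.
Proof.
move=> h; rewrite /occ big1 // => w wC; rewrite big1 // => p _.
by apply/eqP; rewrite eqb0; apply/negP => /and3P [/eqP e1 /eqP e2 /eqP e3];
  apply: h (alternatingC wC) e1 e2 e3.
Qed.

Lemma occ_squarel x z : 0 < x -> occ C x x z = 0.
Proof.
move=> x0; apply: occ0 => w p hw e1 e2 _.
by move: x0; rewrite (letter_neq hw e1 e2).
Qed.

Lemma occ_squarer x z : 0 < x -> occ C z x x = 0.
Proof.
move=> x0; apply: occ0 => w p hw _ e1 e2.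
by move: x0; rewrite (letter_neq hw e1 e2).
Qed.

Lemma occ_braid_up k : 1 < k -> occ C k k.+1 k = 0.
Proof.
move=> k1; apply: occ0 => w p hw e1 e2 e3.
have := letter_le w p; rewrite e1 => hk.
(* The pair [k.-1], [k] contains [k] but not [k.+1]; it is admissible because [1 < k]. *)
apply: (letter_braid (k := k.-1) hw _ _ _ e1 e2 e3); lia.
Qed.

Lemma occ_braid_down k : occ C k.+1 k k.+1 = 0.
Proof.
apply: occ0 => w p hw e1 e2 e3.
have := letter_le w p; rewrite e1 => hk.
apply: (letter_braid (k := k.+1) hw _ _ _ e1 e2 e3); lia.
Qed.

Lemma occ_large x y z : (r < x) || (r < y) || (r < z) -> occ C x y z = 0.
Proof.
move=> h; apply: occ0 => w p _ e1 e2 e3.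
have := letter_le w p; have := letter_le w p.+1; have := letter_le w p.+2.
by rewrite e1 e2 e3; move: h; lia.
Qed.

(** * Both ends of the words, and telescoping *)

Hypothesis r_gt1 : 1 < r.

Lemma letters_range w : all (fun x => 0 < x <= r) [seq (val i).+1 | i <- w].
Proof. by apply/allP => x /mapP [i _ ->] /=. Qed.

Lemma letters_start w : alternating_word w -> letter w 1 = 1 /\ letter w 2 = 2.
Proof.
move=> hw; have [t e] := alternating_start r_gt1 (letters_range w) hw.
by rewrite /letter /padded e.
Qed.

(** Alternation is invariant under reversal, so this is the statement on the first letters read
    backwards. *)
Lemma letters_end w : alternating_word w ->
  [/\ 1 < m, letter w m = 1 & letter w m.-1 = 2].
Proof.
move=> hw; have hr k : 0 < k <= r ->
    alternating k (subword k (rev [seq (val i).+1 | i <- w])).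
  by rewrite alternating_rev; apply: hw.
have [|t] := alternating_start r_gt1 _ hr; first by rewrite all_rev letters_range.
move/(congr1 rev); rewrite revK !rev_cons => e.
have em : m = (size t).+2.
  rewrite -(size_tuple w) -(size_map (fun i : 'I_r => (val i).+1)) e.
  by rewrite !size_rcons size_rev.
rewrite /letter /padded e em /= !nth_rcons !size_rcons size_rev !ltnSn !eqxx.
by rewrite !ltnn ltnS leqnSn.
Qed.

(** A 0 followed by a nonzero letter can only be the left padding. *)
Lemma occ_start x y : 0 < x -> occ C 0 x y = ((x == 1) && (y == 2)) * #|C|.
Proof.
move=> x0; rewrite /occ mulnC -sum_nat_const; apply: eq_bigr => w wC.
have [e1 e2] := letters_start (alternatingC wC).
rewrite big_ord_recl /= e1 e2 !(eq_sym _ x) !(eq_sym _ y) big1 ?addn0 // => p _.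
apply/eqP; rewrite eqb0; apply/negP => /and3P [/eqP e3 /eqP e4 _].
have := letter_gt0 w p.+1; have := letter_gt0 w p.+2.
by move: e3 e4; rewrite /bump /= !add1n => -> ->; rewrite x0; lia.
Qed.

Lemma occ_end x y : 0 < y -> occ C x y 0 = ((x == 2) && (y == 1)) * #|C|.
Proof.
move=> y0; rewrite /occ mulnC -sum_nat_const; apply: eq_bigr => w wC.
have [m1 e1 e2] := letters_end (alternatingC wC).
(* The last two letters sit at [m.-1] and [m], the right padding at [m.+1]. *)
have hm : m.-1 < m.+2 by lia.
rewrite (bigD1 (Ordinal hm)) //= prednK ?(ltnW m1) // e1 e2 letter_out // eqxx andbT.
rewrite !(eq_sym _ x) !(eq_sym _ y) big1 ?addn0 // => p.
rewrite -val_eqE /= => hp.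
apply/eqP; rewrite eqb0; apply/negP => /and3P [_ /eqP e3 /eqP e4].
have := letter_gt0 w p.+1; have := letter_gt0 w p.+2.
by rewrite e3 e4 y0; lia.
Qed.

Lemma occ_flow_near x y k : 0 < k -> x \in [:: k; k.+1] -> y \in [:: k; k.+1] ->
  occ C k.-1 x y + occ C k x y + occ C k.+1 x y + occ C k.+2 x y =
  occ C x y k.-1 + occ C x y k + occ C x y k.+1 + occ C x y k.+2.
Proof.
rewrite !inE => k0 hx hy.
have x0 : 0 < x by lia.
have y0 : 0 < y by lia.
have [n hn hkn] : exists2 n, r < n & k.+3 <= n by exists (k.+3 + r); lia.
have := occ_flow x0 y0 hn.
rewrite -!(big_mkord xpredT (fun z => occ C z x y)).
rewrite -!(big_mkord xpredT (fun z => occ C x y z)).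
(* A nonzero [z] moves across [x] and then [y]. For [z = 0] one has [1 < k], so [x] and [y] exceed 1
   and both counts vanish. *)
have hfar z : (z < k.-1) || (k.+2 < z) -> occ C z x y = occ C x y z.
  case: z => [|z] hz; last first.
    by rewrite occ_swapl ?(@occ_swapr y z.+1) //; rewrite /far; lia.
  by rewrite occ_start // occ_end //; lia.
have split4 (f : nat -> nat) : \sum_(0 <= z < n) f z =
    \sum_(0 <= z < k.-1) f z + (f k.-1 + f k + f k.+1 + f k.+2)
      + \sum_(k.+3 <= z < n) f z.
  rewrite (@big_cat_nat _ _ _ k.+3) //=; congr (_ + _); rewrite !big_nat_recr //=.
  by rewrite -[X in \sum_(0 <= z < X) _](prednK k0) big_nat_recr //= !addnA.
rewrite !split4.
have -> : \sum_(0 <= z < k.-1) occ C z x y = \sum_(0 <= z < k.-1) occ C x y z.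
  by apply: eq_big_nat => z hz; apply: hfar; lia.
have -> : \sum_(k.+3 <= z < n) occ C z x y = \sum_(k.+3 <= z < n) occ C x y z.
  by apply: eq_big_nat => z hz; apply: hfar; lia.
by lia.
Qed.

Lemma occ_121 : occ C 1 2 1 = #|C|.
Proof.
(* This is [K k + 2 * occ C 1 2 1 = 2 * #|C|] without subtraction. *)
have main k : 1 < k ->
    occ C k.-1 k k.+1 + occ C k.+1 k k.-1 + 2 * occ C 1 2 1 =
    occ C k.-1 k.+1 k + occ C k k.-1 k.+1 + 2 * #|C|.
  elim: k => // k IH k1; case: (ltnP 1 k) => hk; last first.
    have -> : k = 1 by lia.
    have := @occ_flow_near 1 2 1 isT isT isT.
    have := @occ_flow_near 2 1 1 isT isT isT.
    rewrite /= !occ_start // !occ_end // !occ_squarel // !occ_squarer // !occ_braid_down.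
    rewrite (@occ_swapl 3 1 2) //=; lia.
  move: {IH}(IH hk).
  have := @occ_flow_near k k.+1 k (ltnW hk); rewrite !inE !eqxx ?orbT => /(_ isT isT).
  have := @occ_flow_near k.+1 k k (ltnW hk); rewrite !inE !eqxx ?orbT => /(_ isT isT).
  rewrite !occ_squarel ?(ltnW hk) // !occ_squarer ?(ltnW hk) //.
  rewrite !occ_braid_down occ_braid_up //.
  (* The swaps bring the outer terms of the flow for [k], [k.+1] into the form in which they occur
     in [K(k.+1)] and [K(k)]. *)
  rewrite (@occ_swapl k.+2 k k.+1) ?(@occ_swapr k.+1 k.-1 k) ?/far /=; lia.
have := main r r_gt1.
rewrite !(@occ_large _ _ r.+1) ?(@occ_large r.+1) ?(@occ_large _ r.+1).
  by lia.
all: lia.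
Qed.

End Class.

Lemma br_occ w : alternating_word w -> br w = \sum_(p < m.+2)
    [&& letter w p == 1, letter w p.+1 == 2 & letter w p.+2 == 1].
Proof.
move=> hw; rewrite big_ord_recl big_ord_recr /= [letter w m.+1]letter_out //= addn0.
rewrite /br cardsE -sum1_card big_mkcond /=; apply: eq_bigr => p _.
rewrite /bump /= !add1n unfold_in; case: existsP => [[q /existsP [t]]|hn].
  case/and3P => /eqP eq /eqP et /andP [/eqP e1 e2].
  have := letterS w q; have := letterS w t; have := letterS w p.
  rewrite eq et e1; set a := (tnth w p).+1; set b := (tnth w q).+1 => ha hc hb.
  have hr : 0 < a <= r by rewrite -ha letter_le ha.
  case/orP: e2 => /eqP e2.
    have eb : b = a.+1 by rewrite /b e2.
    have ea : a = 1.
      have [//|a1] : a = 1 \/ 1 < a by lia.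
      by case: (letter_braid (k := a.-1) hw _ _ _ ha hb hc); lia.
    by rewrite ha hb hc eb ea.
  have eb : a = b.+1 by rewrite /a e2.
  by case: (letter_braid (k := a) hw _ _ _ ha hb hc); lia.
case: and3P => // -[/eqP e1 /eqP e2 /eqP e3]; case: hn.
have h3 : p.+2 < m by have := letter_gt0 w p.+3; rewrite e3; lia.
have h2 : p.+1 < m by apply: ltnW.
exists (Ordinal h2); apply/existsP; exists (Ordinal h3); rewrite /= !eqxx /=.
move: e1 e2 e3; rewrite letterS (letterS w (Ordinal h2)) (letterS w (Ordinal h3)).
by move=> [->] [->] [->].
Qed.
End Words.

(** * Alternation of [w0] *)

Lemma subword_iota k j : 0 < k ->
  subword k (iota 1 j) = if j < k then [::] else if j == k then [:: k] else [:: k; k.+1].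
Proof.
move=> k0; elim: j => [|j IH]; first by rewrite k0.
rewrite -[X in iota 1 X]addn1 iotaD /subword filter_cat -/(subword _ _) IH /= add1n.
by case: (ltngtP j.+1 k) => h; case: (ltngtP j k) => h'; rewrite /= ?eqSS;
  repeat case: eqP => /=; try lia; intros; subst.
Qed.

Definition staircase (r : nat) : seq nat :=
  flatten [seq iota 1 j | j <- rev (iota 1 r)].

Lemma staircaseS r : staircase r.+1 = iota 1 r.+1 ++ staircase r.
Proof. by rewrite /staircase -[X in rev (iota 1 X)]addn1 iotaD rev_cat add1n. Qed.

(** Induction on [r]: the new first block contributes nothing if [r.+1 < k], the initial single [k]
    if [r.+1 = k], and otherwise [k], [k.+1] in front of a sequence starting with [k]. *)
Lemma alternating_staircase k r : 0 < k ->
  if r < k then subword k (staircase r) == [::]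
  else alternating k (subword k (staircase r)).
Proof.
move=> k0; elim: r => [|r IH]; first by rewrite k0.
rewrite staircaseS /subword filter_cat -!/(subword _ _) subword_iota //.
case: (ltngtP r.+1 k) => h.
- by move: IH; rewrite (ltnW h).
- move: IH; rewrite ifF; last by lia.
  set t := subword _ _; case: t => [|x t] /and3P [/= /eqP e1 e2 e3]; first by lia.
  by rewrite /alternating /= eqxx e2 e3 e1; lia.
- by move: IH; rewrite h leqnn => /eqP ->; rewrite /alternating /= !eqxx.
Qed.

Lemma w0_seq_letters n :
  [seq (val i).+1 | i <- w0_seq n] = staircase n.-1.
Proof.
rewrite /w0_seq map_flatten -map_comp; congr flatten; apply/eq_in_map => j.
rewrite mem_rev mem_iota add1n ltnS => /andP [_ hj] /=.
rewrite map_take (map_comp S val) val_enum_ord -(iotaDl 1 0).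
by rewrite take_iota (minn_idPl hj).
Qed.

Lemma alternating_word_w0 n : alternating_word (w0 n).
Proof.
move=> k /andP [k0 hk]; rewrite w0_seq_letters.
by have /= := @alternating_staircase k n.-1 k0; rewrite ltnNge hk.
Qed.

(** * The commutation class and the average *)

Lemma mem_comm_class_step r m (w u v : word r m) :
  comm_step u v -> (u \in comm_class w) = (v \in comm_class w).
Proof.
move=> h; rewrite !inE; apply/idP/idP => hc.
  exact: connect_trans hc (connect1 h).
exact: connect_trans hc (connect1 (comm_step_sym h)).
Qed.

(** The subwords on [k], [k.+1] are constant along a path of commutation steps. *)
Lemma alternating_word_class r m (w u : word r m) :
  alternating_word w -> u \in comm_class w -> alternating_word u.
Proof.
move=> hw; rewrite inE => /connectP [s hs ->].
elim: s w hw hs => //= v s IH w hw /andP [hv hs]; apply: IH hs.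
move=> k hk; have k0 : 0 < k by case/andP: hk.
by rewrite -subword_padded // -(subword_step k hv) subword_padded //; apply: hw.
Qed.

Lemma sum_br_comm_class r m (w : word r m) : 1 < r -> alternating_word w ->
  \sum_(u in comm_class w) br u = #|comm_class w|.
Proof.
move=> hr hw.
have alt u := @alternating_word_class _ _ w u hw.
rewrite -(occ_121 (@mem_comm_class_step _ _ w) alt hr).
by apply: eq_bigr => u hu; apply/br_occ/alt.
Qed.

Import GRing.Theory Num.Theory.
Local Open Scope ring_scope.

Theorem theorem1p2 (n : nat) (hn : (3 <= n)%N) :
  let C := comm_class (w0 n) in
  (\sum_(w in C) (br w)%:R) / #|C|%:R = 1 :> rat
  /\ (\sum_(w in C) br w)%N = #|C|.
Proof.
move=> C; have hC : (\sum_(w in C) br w)%N = #|C|.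
  by apply: sum_br_comm_class (@alternating_word_w0 n); lia.
split=> //; rewrite -natr_sum hC divff // pnatr_eq0 -lt0n.
by apply/card_gt0P; exists (w0 n); rewrite inE connect0.
Qed.
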